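(* Let $P(z)\in\mathbb{C}[z]$ be a (non-zero) homogeneous HN polynomial of degree $d\ge4$ and set $r_0:=(2^{d+1}|P|)^{\frac{1}{2-d}}$. Then the inversion pair $Q(z)$ of $P(z)$ converges over the open ball $B(0,r_0)$.
   Context: $z=(z_1,\dots,z_n)$, $\nabla g=(\partial g/\partial z_1,\dots,\partial g/\partial z_n)$. A polynomial is HN (Hessian nilpotent) if its Hessian matrix $(\partial^2P/\partial z_i\partial z_j)_{n\times n}$ is nilpotent. $|P|:=\max\{|P(z)| : z\in S^{2n-1}\}$, where $S^{2n-1}$ is the unit sphere of $\mathbb{C}^n$ (Euclidean/Hermitian norm), and $B(0,r)$ is the open ball in $\mathbb{C}^n$ centered at $0$ of radius $r$ in that norm. Inversion pair: the formal map $F(z)=z-\nabla P(z)$ has a formal inverse under composition, of the form $G(z)=z+\nabla Q(z)$ for a unique $Q(z)\in\mathbb{C}[[z]]$ all of whose monomials have degree at least $2$; $Q$ is the inversion pair of $P$. (It is the value at $t=1$ of the $Q_t\in\mathbb{C}[t][[z]]$ such that $z+t\nabla Q_t$ is the formal inverse of $z-t\nabla P$.) *)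

(* Defs.v *)
From HB Require Import structures.
(* multinomials' mpoly has to be imported before the files of
   mathcomp-analysis: in the other order their notations clash. *)
From mathcomp Require Import all_boot all_order all_algebra.
From mathcomp Require Import mpoly complex.
From mathcomp Require Import classical_sets reals ereal esum exp.

Set Implicit Arguments.
Unset Strict Implicit.
Unset Printing Implicit Defensive.

Import Order.TTheory GRing.Theory Num.Theory.
Import ComplexField.

Local Open Scope classical_set_scope.
Local Open Scope ring_scope.

Definition hessian (C : comNzRingType) (n : nat) (P : {mpoly C[n]}) :
  'M[{mpoly C[n]}]_n := \matrix_(i, j) (P^`M(i))^`M(j).

Definition hessian_nilpotent (C : comNzRingType) (n : nat) (P : {mpoly C[n]}) :
  Prop := exists k : nat, hessian P ^+ k = 0.

(* C[[z_1, ..., z_n]], a series being given by its coefficients. *)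
Definition fps (C : comNzRingType) (n : nat) := 'X_{1..n} -> C.

Section FormalPowerSeries.
Variables (C : comNzRingType) (n : nat).
Implicit Types (f : fps C n) (g : 'I_n -> fps C n).

Definition fps_of_mpoly (p : {mpoly C[n]}) : fps C n := fun m => p@_m.

Definition fps_deriv (i : 'I_n) f : fps C n :=
  fun m => f (m + U_(i))%MM *+ (m i).+1.

Definition fps_trunc (k : nat) f : {mpoly C[n]} :=
  \sum_(m : 'X_{1..n < k.+1}) f m *: 'X_[m].

(* f(g_1, ..., g_n), meaningful when every g_i has zero constant term: the
   coefficient of z^m then depends only on the terms of total degree at most
   mdeg m of f and of the g_i, so it is computed on these truncations. *)
Definition fps_comp f g : fps C n := fun m =>
  (fps_trunc (mdeg m) f \mPo
     [tuple fps_trunc (mdeg m) (g i) | i < n])@_m.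

Definition formal_map_comp (F G : 'I_n -> fps C n) : 'I_n -> fps C n :=
  fun i => fps_comp (F i) G.

Definition formal_map_id : 'I_n -> fps C n := fun i => fps_of_mpoly 'X_i.

Definition is_formal_inverse (F G : 'I_n -> fps C n) : Prop :=
  (forall i m, formal_map_comp F G i m = formal_map_id i m) /\
  (forall i m, formal_map_comp G F i m = formal_map_id i m).

Definition is_inversion_pair (P : {mpoly C[n]}) (Q : fps C n) : Prop :=
  (forall m : 'X_{1..n}, (mdeg m < 2)%N -> Q m = 0) /\
  is_formal_inverse
    (fun i => fps_of_mpoly ('X_i - P^`M(i)))
    (fun i m => fps_of_mpoly 'X_i m + fps_deriv i Q m).

End FormalPowerSeries.

Section Analytic.
Variables (R : realType) (n : nat).
Implicit Types (z : 'I_n -> R[i]).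

Definition hermitian_norm z : R :=
  Num.sqrt (\sum_(i < n) Normc.normc (z i) ^+ 2).

Definition unit_sphere : set ('I_n -> R[i]) := [set z | hermitian_norm z = 1].

Definition open_ball (r : R) : set ('I_n -> R[i]) :=
  [set z | hermitian_norm z < r].

(* The supremum is a maximum by compactness of the sphere (when 0 < n). *)
Definition sphere_norm (P : {mpoly R[i][n]}) : R :=
  sup [set Normc.normc P.@[z] | z in unit_sphere].

(* Convergence of a power series in several variables at a point, i.e.
   absolute convergence of the family of its terms: the set of multi-indices
   carries no preferred order of summation. *)
Definition fps_converges_at (Q : fps R[i] n) z : Prop :=
  summable [set: 'X_{1..n}]
    (fun m => (Normc.normc (Q m * \prod_(i < n) z i ^+ m i))%:E).

Definition fps_converges_on (Q : fps R[i] n) (D : set ('I_n -> R[i])) : Prop :=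
  forall z, D z -> fps_converges_at Q z.

End Analytic.

(* Main.v *)
(* Write A for the sphere norm of P and |.| for the Hermitian norm. A Parseval
   argument on complex lines gives |grad P(w)| <= c d A |w|^(d-1) with
   c^2 = (1 + 1/d^2)^d <= 4/3, and since d^2 (4/3) (9/4)^(d-1) <= 4^d for d >= 4,
   the map w |-> z + grad P(w) preserves the ball |w| <= (3/2) r0 as soon as
   |z| <= r0. The gradient of Q is determined by the fixed point equation
   G = z + grad P(G), where G = z + grad Q; the Picard iterates of this equation
   are polynomial maps, bounded by (3/2) r0 on the ball of radius r0, which agree
   with G up to higher and higher degree. Cauchy's estimate on a torus of
   polyradius rho with |rho| <= r0 therefore bounds the coefficients of G, hence
   those of Q, by a constant times rho^(-m), and any z in the open ball has
   |z_i| < rho_i for such a rho. Integrals over tori are replaced by averages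
   over roots of unity. *)
Require Import Defs.
From HB Require Import structures.
From mathcomp Require Import all_boot all_order all_algebra.
From mathcomp Require Import ring lra.
From mathcomp Require Import cyclic separable cyclotomic.
From mathcomp Require Import finmap mpoly complex.
From mathcomp Require Import boolp classical_sets cardinality fsbigop.
From mathcomp Require Import reals ereal esum exp.

Set Implicit Arguments.
Unset Strict Implicit.
Unset Printing Implicit Defensive.

Import Order.TTheory GRing.Theory Num.Theory.

Local Open Scope ring_scope.

(** * Averages over roots of unity *)

(** Finite functions index an exponent box, so that sums over monomials become sums over a finite
    type and can be factored coordinatewise. *)
Definition box_mnm (n N : nat) (j : {ffun 'I_n -> 'I_N}) : 'X_{1..n} :=
  [multinom (j i : nat) | i < n].

Lemma box_mnmE (n N : nat) (j : {ffun 'I_n -> 'I_N}) i : box_mnm j i = j i :> nat.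
Proof. exact: mnmE. Qed.

Lemma box_mnm_inord (n N : nat) (m : 'X_{1..n}) : (forall i, (m i < N.+1)%N) ->
  box_mnm [ffun i => inord (m i) : 'I_N.+1] = m.
Proof. by move=> lt_m; apply/mnmP => i; rewrite box_mnmE ffunE inordK. Qed.

Lemma big_box_mnm (V : nmodType) (n N : nat) (s : seq 'X_{1..n})
    (F : 'X_{1..n} -> V) :
  uniq s -> (forall m, m \in s -> forall i, (m i < N.+1)%N) ->
  \sum_(m <- s) F m =
    \sum_(j : {ffun 'I_n -> 'I_N.+1} | box_mnm j \in s) F (box_mnm j).
Proof.
move=> uniq_s lt_s.
have box_inj : injective (@box_mnm n N.+1).
  move=> i j /mnmP eq_ij; apply/ffunP => l; apply/val_inj.
  by have := eq_ij l; rewrite !box_mnmE.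
pose t := [seq box_mnm j | j <- enum {ffun 'I_n -> 'I_N.+1} & box_mnm j \in s].
have /(perm_big _) -> : perm_eq s t.
  apply: uniq_perm => //.
    by rewrite map_inj_uniq // filter_uniq // enum_uniq.
  move=> m; apply/idP/mapP => [s_m|[j]]; last first.
    by rewrite mem_filter => /andP[s_j _] ->.
  exists [ffun i => inord (m i)]; last by rewrite box_mnm_inord // => i; apply: lt_s.
  by rewrite mem_filter mem_enum andbT box_mnm_inord // => i; apply: lt_s.
by rewrite big_map big_filter big_enum_cond.
Qed.

Lemma leq_mdeg (n : nat) (m : 'X_{1..n}) i : (m i <= mdeg m)%N.
Proof. by rewrite mdegE (bigD1 i) //= leq_addr. Qed.

Section DiscreteFourier.
Variable C : numClosedFieldType.

(** ['X^N - 1] is separable in characteristic 0, so it has N distinct roots; N distinct N-th roots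
    of unity include a primitive one. *)
Lemma exists_prim_root (N : nat) : (0 < N)%N -> exists z : C, N.-primitive_root z.
Proof.
move=> N_gt0; pose p : {poly C} := 'X^N - 1.
have [r Dp] := closed_field_poly_normal p.
rewrite (monicP _) ?monicXnsubC // scale1r in Dp.
have rn1: all N.-unity_root r by apply/allP=> z; rewrite -root_prod_XsubC -Dp.
have sz_r: (N < (size r).+1)%N.
  by rewrite -(size_prod_XsubC r id) -Dp size_XnsubC.
have [|z] := hasP (has_prim_root N_gt0 rn1 _ sz_r); last by exists z.
rewrite -separable_prod_XsubC -Dp separable_Xn_sub_1 //.
by rewrite pnatr_eq0 -lt0n.
Qed.

Lemma prim_root_norm1 (N : nat) (z : C) : N.-primitive_root z -> `|z| = 1.
Proof.
move=> pz; apply/eqP; rewrite -(@pexpr_eq1 _ _ N) ?(prim_order_gt0 pz) //.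
by rewrite -normrX prim_expr_order ?normr1.
Qed.

(** The sum is geometric, its ratio [y] being the quotient of two powers of [z]; since [y ^+ N = 1],
    it vanishes unless [y = 1]. *)
Lemma prim_root_orthogonal (N : nat) (z : C) (a b : 'I_N) :
  N.-primitive_root z ->
  \sum_(k < N) z ^+ (a * k) * (z ^+ (b * k))^* = (a == b)%:R * N%:R.
Proof.
move=> pz; have z1 := prim_root_norm1 pz.
have znz : z != 0 by rewrite -normr_eq0 z1 oner_eq0.
have zc : z^* = z^-1.
  by apply: (mulfI znz); rewrite -normCK z1 expr1n divff.
pose y := z ^+ a / z ^+ b.
rewrite (eq_bigr (fun k : 'I_N => y ^+ k)) => [|k _]; last first.
  by rewrite rmorphXn /= zc /y expr_div_n exprVn -!exprM.
have yN : y ^+ N = 1.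
  by rewrite exprMn exprVn -!exprM ![(_ * N)%N]mulnC !exprM (prim_expr_order pz)
             !expr1n divr1.
have [eq_ab|neq_ab] := eqVneq a b.
  rewrite /y eq_ab divff ?expf_neq0 //.
  under eq_bigr do rewrite expr1n.
  by rewrite sumr_const card_ord mul1r.
have y1 : y - 1 != 0.
  apply: contra neq_ab; rewrite subr_eq0 => /eqP y1.
  have: z ^+ a == z ^+ b.
    by apply/eqP/(mulIf (_ : (z ^+ b)^-1 != 0)); rewrite ?invr_eq0 ?divff ?expf_neq0.
  by rewrite (eq_prim_root_expr pz) !modn_small.
by apply: (mulfI y1); rewrite -subrX1 yN subrr mul0r mulr0.
Qed.

(** Stated for abstract orthogonal rows [chi], so that the circle and the torus are both
    instances. *)
Lemma parseval (K J : finType) (chi : J -> K -> C) (a : J -> C) :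
  (forall i j, \sum_k chi i k * (chi j k)^* = (i == j)%:R * #|K|%:R) ->
  \sum_k `|\sum_j a j * chi j k| ^+ 2 = #|K|%:R * \sum_j `|a j| ^+ 2.
Proof.
move=> orth.
under eq_bigr => k _ do rewrite normCK rmorph_sum /= mulr_suml.
rewrite exchange_big mulr_sumr /=; apply: eq_bigr => i _.
under eq_bigr => k _ do rewrite mulr_sumr.
rewrite exchange_big /= (bigD1 i) //= [X in _ + X]big1 => [|j neq_ji].
  have -> : #|K|%:R = \sum_k chi i k * (chi i k)^* by rewrite orth eqxx mul1r.
  rewrite addr0 mulr_suml; apply: eq_bigr => k _.
  by rewrite rmorphM normCK /=; ring.
transitivity (a i * (a j)^* * \sum_k chi i k * (chi j k)^*).
  by rewrite mulr_sumr; apply: eq_bigr => k _; rewrite rmorphM /=; ring.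
by rewrite orth eq_sym (negbTE neq_ji) mul0r mulr0.
Qed.

Lemma bessel (K J : finType) (chi : J -> K -> C) (a : J -> C) (M : C) :
  (0 < #|K|)%N ->
  (forall i j, \sum_k chi i k * (chi j k)^* = (i == j)%:R * #|K|%:R) ->
  (forall k, `|\sum_j a j * chi j k| ^+ 2 <= M) ->
  \sum_j `|a j| ^+ 2 <= M.
Proof.
move=> K_gt0 orth leM.
rewrite -(@ler_pM2l _ #|K|%:R) ?ltr0n // -(parseval _ orth) mulr_natl -sumr_const.
exact: ler_sum.
Qed.

(** Bessel's inequality over the roots of unity scaled by [e], keeping only the first two terms. *)
Lemma poly_coef01_bound (p : {poly C}) (e M : C) :
  0 <= e -> (forall t, `|t| = e -> `|p.[t]| ^+ 2 <= M) ->
  `|p`_0| ^+ 2 + e ^+ 2 * `|p`_1| ^+ 2 <= M.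
Proof.
(* The two extra indices ensure that coefficients 0 and 1 occur even when [p] is zero. *)
move=> e_ge0 leM; pose N := (size p).+2.
have [z pz] := exists_prim_root (ltn0Sn (size p).+1).
have := @bessel 'I_N 'I_N (fun a k => z ^+ (a * k)) (fun j => p`_j * e ^+ j) M.
rewrite card_ord => /(_ isT) H.
apply: le_trans (H _ _); last 2 first.
- by move=> i j; apply: prim_root_orthogonal.
- move=> k; have := leM (e * z ^+ k).
  rewrite normrM normrX (prim_root_norm1 pz) expr1n mulr1 ger0_norm // => /(_ erefl).
  rewrite (@horner_coef_wide _ N) ?leqW //.
  congr (`|_| ^+ 2 <= _); apply: eq_bigr => j _.
  by rewrite exprMn mulrA mulnC exprM.
rewrite /N !big_ord_recl /= addrA.
rewrite expr0 mulr1 expr1 normrM exprMn (ger0_norm e_ge0) [_ ^+ 2 * e ^+ 2]mulrC.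
by rewrite lerDl sumr_ge0 // => i _; rewrite exprn_ge0.
Qed.

(** Cauchy's estimate, squared: Bessel's inequality over a grid of roots of unity on the torus,
    keeping a single term. *)
Lemma mcoeff_torus_bound (n : nat) (p : {mpoly C[n]}) (rho : 'I_n -> C) (M : C)
    (m : 'X_{1..n}) :
  (forall i, 0 <= rho i) ->
  (forall x, (forall i, `|x i| = rho i) -> `|p.@[x]| ^+ 2 <= M) ->
  (`|p@_m| * \prod_(i < n) rho i ^+ m i) ^+ 2 <= M.
Proof.
move=> rho_ge0 leM.
(* The box must contain the support of [p] and also [m], which may lie outside that support. *)
pose N := maxn (msize p) (mdeg m).
have [z pz] := exists_prim_root (ltn0Sn (maxn (msize p) (mdeg m))).
pose T := {ffun 'I_n -> 'I_N.+1}.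
pose chi (j k : T) : C := \prod_i z ^+ (j i * k i).
have orth (i j : T) : \sum_k chi i k * (chi j k)^* = (i == j)%:R * #|T|%:R.
  rewrite /chi.
  under eq_bigr => k _ do rewrite rmorph_prod -big_split /=.
  (* The sum over the grid factors into one-dimensional orthogonality relations. *)
  rewrite -(bigA_distr_bigA
    (fun l (k : 'I_N.+1) => z ^+ (i l * k) * (z ^+ (j l * k))^*)).
  under eq_bigr => l _ do rewrite prim_root_orthogonal //.
  rewrite big_split /= prodr_const card_ord card_ffun !card_ord natrX.
  congr (_ * _); have [->|/eqP neq_ij] := eqVneq i j.
    by rewrite big1 // => l _; rewrite eqxx.
  have /existsP[l neq_l] : [exists l, i l != j l].
    rewrite -negb_forall; apply/negP => /forallP eq_ij; apply: neq_ij.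
    by apply/ffunP => l; apply/eqP.
  by rewrite (bigD1 l) //= (negbTE neq_l) mul0r.
have := @bessel T T chi (fun j => p@_(box_mnm j) * \prod_i rho i ^+ j i) M.
have -> : (0 < #|T|)%N by rewrite card_ffun card_ord expn_gt0.
move=> /(_ isT orth) H.
pose jm : T := [ffun i => inord (m i)].
have jmE i : jm i = m i :> nat.
  by rewrite ffunE inordK // ltnS leq_max leq_mdeg orbT.
have box_jm : box_mnm jm = m.
  by apply: box_mnm_inord => i; rewrite ltnS leq_max leq_mdeg orbT.
apply: le_trans (H _).
  rewrite (bigD1 jm) //= box_jm.
  rewrite [X in `|_ * X|](eq_bigr (fun i => rho i ^+ m i)) => [|i _]; last first.
    by rewrite jmE.
  rewrite normrM [X in _ <= (_ * X) ^+ _ + _]ger0_norm; last first.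
    by rewrite prodr_ge0 // => i _; rewrite exprn_ge0.
  by rewrite lerDl sumr_ge0 // => i _; rewrite exprn_ge0.
move=> k; have := leM (fun i => rho i * z ^+ k i).
have xE i : `|rho i * z ^+ k i| = rho i.
  by rewrite normrM normrX (prim_root_norm1 pz) expr1n mulr1 ger0_norm.
move=> /(_ xE); congr (`|_| ^+ 2 <= _).
rewrite mevalE.
rewrite (@big_box_mnm _ _ N) //; last first.
  move=> m' /msize_mdeg_lt lt_m' i; rewrite ltnS leq_max.
  by rewrite (leq_trans (leq_mdeg m' i)) // ltnW.
rewrite [RHS](bigID (fun j => box_mnm j \in msupp p)) /=.
rewrite [X in _ + X]big1 ?addr0 => [|j /memN_msupp_eq0 ->]; last by rewrite !mul0r.
apply: eq_bigr => j _; rewrite -mulrA -big_split /=; congr (_ * _).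
by apply: eq_bigr => i _; rewrite box_mnmE exprMn -exprM [(k i * _)%N]mulnC.
Qed.
End DiscreteFourier.

(** * The gradient of a homogeneous polynomial *)

Lemma mnm_ind (n : nat) (T : 'X_{1..n} -> Prop) :
  T 0%MM -> (forall m i, T m -> T (m + U_(i))%MM) -> forall m, T m.
Proof.
move=> T0 TS m; have [k] := ubnP (mdeg m); elim: k m => // k IHk m lt_mk.
have [/eqP|m_neq0] := eqVneq (mdeg m) 0%N; first by rewrite mdeg_eq0 => /eqP->.
have /existsP[i m_i] : [exists i, m i != 0%N].
  rewrite -negb_forall; apply: contra m_neq0 => /forallP m0.
  by rewrite mdegE big1 // => i _; apply/eqP.
have le_im : (U_(i) <= m)%MM by rewrite lep1mP.
rewrite -(submK le_im); apply/TS/IHk.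
by move: lt_mk; rewrite -{1}(submK le_im) mdegD mdeg1 addn1.
Qed.

Lemma mpoly_ring_ind (A : comNzRingType) (n : nat) (T : {mpoly A[n]} -> Prop) :
  (forall c, T c%:MP) -> (forall i, T 'X_i) ->
  (forall p q, T p -> T q -> T (p + q)) ->
  (forall p q, T p -> T q -> T (p * q)) -> forall p, T p.
Proof.
move=> TC TX TD TM; elim/mpolyind => [|c m p _ _ Tp]; first by rewrite -mpolyC0.
apply: TD => //; rewrite -mul_mpolyC; apply: (TM) => //.
elim/mnm_ind: m => [|m i Tm]; first by rewrite mpolyX0 -mpolyC1.
by rewrite mpolyXD; apply: TM.
Qed.

Lemma dhomog_mderiv (A : comNzRingType) (n d : nat) (p : {mpoly A[n]}) i :
  p \is d.+1.-homog -> p^`M(i) \is d.-homog.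
Proof.
move=> hp; apply/dhomogP => m /=; rewrite mcoeff_msupp mcoeff_deriv => nz.
have /(dhomog_mf hp) /= : (m + U_(i))%MM \in msupp p.
  by rewrite mcoeff_msupp; apply: contraNneq nz => ->; rewrite mul0rn.
by rewrite mdegD mdeg1 addn1 => -[].
Qed.

Section GradientBound.
Variables (C : numClosedFieldType) (n : nat).
Implicit Types (p : {mpoly C[n]}) (z w v : 'I_n -> C) (m : 'X_{1..n}).

(** Squared and [C]-valued, so that the estimates below are algebraic and need no square root of a
    norm. *)
Definition sqnorm z : C := \sum_i `|z i| ^+ 2.

Lemma sqnorm_ge0 z : 0 <= sqnorm z.
Proof. by apply: sumr_ge0 => i _; rewrite exprn_ge0. Qed.

Lemma le_sqnorm z i : `|z i| ^+ 2 <= sqnorm z.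
Proof.
by rewrite /sqnorm (bigD1 i) //= lerDl sumr_ge0 // => j _; rewrite exprn_ge0.
Qed.

Lemma sqnorm_eq0 z : sqnorm z = 0 -> z =1 fun=> 0.
Proof.
move=> z0 i; apply/eqP; rewrite -normr_eq0 -sqrf_eq0.
by rewrite eq_le exprn_ge0 // -z0 le_sqnorm.
Qed.

Definition line_poly w v p : {poly C} :=
  mmap (@polyC C) (fun i => (w i)%:P + v i *: 'X) p.

Lemma horner_line_poly w v p t :
  (line_poly w v p).[t] = p.@[fun i => w i + t * v i].
Proof.
elim/mpoly_ring_ind: p => [c|i|p q IHp IHq|p q IHp IHq].
- by rewrite /line_poly mmapC mevalC hornerC.
- by rewrite /line_poly mmapX mmap1U mevalXU !hornerE mulrC.
- by rewrite /line_poly mmapD mevalD hornerD IHp IHq.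
- by rewrite /line_poly rmorphM mevalM hornerM IHp IHq.
Qed.

Lemma coef0_line_poly w v p : (line_poly w v p)`_0 = p.@[w].
Proof.
rewrite -horner_coef0 horner_line_poly; apply: meval_eq => i.
by rewrite mul0r addr0.
Qed.

(** This is the derivative of [p] at [w] in the direction [v]; both sides obey the Leibniz rule, so
    checking constants and variables is enough. *)
Lemma coef1_line_poly w v p :
  (line_poly w v p)`_1 = \sum_i (p^`M(i)).@[w] * v i.
Proof.
elim/mpoly_ring_ind: p => [c|i|p q IHp IHq|p q IHp IHq].
- rewrite /line_poly mmapC coefC big1 // => i _.
  by rewrite mderivC meval0 mul0r.
- rewrite /line_poly mmapX mmap1U !coefE add0r mulr1 (bigD1 i) //= big1.
    have -> : 'X_i^`M(i) = 1 :> {mpoly C[n]}.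
      rewrite mderivX mnm1E eqxx scale1r -mpolyX0; congr 'X_[_].
      by apply/mnmP => j; rewrite mnmBE mnm0E subnn.
    by rewrite meval1 mul1r addr0.
  move=> j neq_ji; rewrite mderivX mnm1E eq_sym (negbTE neq_ji) scale0r.
  by rewrite meval0 mul0r.
- rewrite /line_poly mmapD coefD -!/(line_poly _ _ _) IHp IHq -big_split /=.
  by apply: eq_bigr => i _; rewrite mderivD mevalD mulrDl.
- rewrite /line_poly rmorphM /= -!/(line_poly _ _ _) coefM !big_ord_recl big_ord0.
  rewrite /= ?coef0_line_poly IHp IHq addr0.
  rewrite [X in X + _]mulr_sumr [X in _ + X]mulr_suml -big_split /=.
  by apply: eq_bigr => i _; rewrite mderivM mevalD !mevalM; ring.
Qed.

Lemma euler_dhomog (d : nat) p : p \is d.-homog ->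
  \sum_i 'X_i * p^`M(i) = d%:R *: p.
Proof.
move=> hp; rewrite {2}[p]mpolyE scaler_sumr.
rewrite (eq_bigr (fun i => \sum_(m <- msupp p) 'X_i * (p@_m *: 'X_[m])^`M(i)));
  last first.
  by move=> i _; rewrite -mulr_sumr -raddf_sum -mpolyE.
rewrite exchange_big /=; apply: eq_big_seq => m /(dhomog_mf hp) /= <-.
under eq_bigr => i _ do rewrite mderivZ mderivX.
rewrite mdegE natr_sum scaler_suml; apply: eq_bigr => i _.
rewrite -!scalerAr scalerA scalerA mulrC.
(* Subtraction of multi-indices is truncated, so a variable absent from the monomial is treated
   apart. *)
have [->|mi] := eqVneq (m i) 0%N; first by rewrite !mul0r !scale0r.
by congr (_ *: _); rewrite mulrC -mpolyXD submK // lep1mP.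
Qed.

Lemma meval_dhomogZ (d : nat) p z c : p \is d.-homog ->
  p.@[fun i => c * z i] = c ^+ d * p.@[z].
Proof.
move=> hp; rewrite !mevalE mulr_sumr; apply: eq_big_seq => m /(dhomog_mf hp) /= <-.
under eq_bigr => i _ do rewrite exprMn.
by rewrite big_split /= prodrXr -mdegE; ring.
Qed.

Lemma meval_dhomog0 (d : nat) p z : p \is d.+1.-homog -> sqnorm z = 0 -> p.@[z] = 0.
Proof.
move=> hp /sqnorm_eq0 z0.
rewrite (meval_eq _ (_ : _ =1 fun i => 0 * z i)) => [|i]; last by rewrite z0 mul0r.
by rewrite (meval_dhomogZ _ _ hp) expr0n mul0r.
Qed.

(* For v orthogonal to w one has |w + t v|^2 = |w|^2 + |t|^2 |v|^2. Take for v the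
   component of the conjugate gradient orthogonal to w: the first two Taylor
   coefficients of p (w + t v) in t are p(w), which by Euler's identity gives the
   component of the gradient along w, and |v|^2. Parseval on the circle
   |t| |v| = |w| / d weights both exactly as in the squared norm of the gradient. *)
Lemma gradient_bound (d : nat) p w (A : C) :
  (1 < d)%N -> p \is d.-homog -> 0 <= A ->
  (forall z, `|p.@[z]| ^+ 2 <= A * sqnorm z ^+ d) ->
  sqnorm (fun i => (p^`M(i)).@[w]) <=
    d%:R ^+ 2 * (1 + d%:R ^- 2) ^+ d * A * sqnorm w ^+ d.-1.
Proof.
move=> d_gt1 hp A_ge0 leA; set g := fun i => _; set r := sqnorm w.
have d_gt0 : (0 < d%:R :> C) by rewrite ltr0n ltnW.
have d_neq0 := lt0r_neq0 d_gt0.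
have r_ge0 : 0 <= r := sqnorm_ge0 w.
have [r0|r_neq0] := eqVneq r 0.
  suff g0 i : g i = 0.
    rewrite /sqnorm big1 => [|i _]; last by rewrite g0 normr0 expr0n.
    by rewrite !mulr_ge0 ?exprn_ge0 ?addr_ge0 ?invr_ge0 ?exprn_ge0 ?ler0n.
  rewrite /g; case: d d_gt1 hp {leA d_gt0 d_neq0} => [|[|d]] // _ hp.
  by apply: (@meval_dhomog0 d) => //; apply: dhomog_mderiv.
have r_gt0 : 0 < r by rewrite lt_def r_neq0.
(* By Euler's identity [D] pairs the gradient with [w], so [c] is the coefficient of the projection
   of the conjugate gradient on [w]. *)
pose D := d%:R * p.@[w]; pose c := D^* / r.
have DE : \sum_i w i * g i = D.
  rewrite /D -mevalZ -(euler_dhomog hp) raddf_sum /=.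
  by apply: eq_bigr => i _; rewrite mevalM mevalXU.
have DcE : \sum_i (w i)^* * (g i)^* = D^*.
  by rewrite -DE rmorph_sum; apply: eq_bigr => i _; rewrite rmorphM.
have rE : r = \sum_i w i * (w i)^* by apply: eq_bigr => i _; rewrite normCK.
pose v i := (g i)^* - c * w i; pose s := sqnorm v.
have orth : \sum_i v i * (w i)^* = 0.
  transitivity (\sum_i (w i)^* * (g i)^* - c * \sum_i w i * (w i)^*).
    by rewrite mulr_sumr -sumrB; apply: eq_bigr => i _; rewrite /v; ring.
  by rewrite DcE -rE /c divfK // subrr.
have orthc : \sum_i (v i)^* * w i = 0.
  transitivity ((\sum_i v i * (w i)^*)^*); last by rewrite orth conjC0.
  rewrite rmorph_sum /=; apply: eq_bigr => i _.
  by rewrite rmorphM /= conjCK.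
have sE : s = \sum_i g i * v i.
  transitivity (\sum_i g i * v i - c^* * \sum_i v i * (w i)^*).
    rewrite mulr_sumr -sumrB; apply: eq_bigr => i _.
    by rewrite normCK {2}/v rmorphB rmorphM /= conjCK; ring.
  by rewrite orth mulr0 subr0.
(* Pythagoras for the components of the conjugate gradient orthogonal to [w] and along [w]. *)
have SE : sqnorm g = s + d%:R ^+ 2 / r * `|p.@[w]| ^+ 2.
  have -> : d%:R ^+ 2 / r * `|p.@[w]| ^+ 2 = c * D.
    by rewrite /c /D normCK rmorphM /= conjC_nat; ring.
  rewrite sE -DE mulr_sumr -big_split /=; apply: eq_bigr => i _.
  by rewrite normCK /v; ring.
have lineE t : sqnorm (fun i => w i + t * v i) = r + `|t| ^+ 2 * s.
  transitivity (r + `|t| ^+ 2 * s + t * \sum_i v i * (w i)^*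
                + t^* * \sum_i (v i)^* * w i).
    rewrite !mulr_sumr rE -!big_split /=; apply: eq_bigr => i _.
    by rewrite !normCK rmorphD rmorphM /=; ring.
  by rewrite orth orthc !mulr0 !addr0.
have s_ge0 : 0 <= s := sqnorm_ge0 v.
have key : `|p.@[w]| ^+ 2 + r * s / d%:R ^+ 2 <=
           A * (r * (1 + d%:R ^- 2)) ^+ d.
  (* The radius [e] below divides by [s]; when [s] is zero, the bound at the point [w] alone
     suffices. *)
  have [->|s_neq0] := eqVneq s 0.
    rewrite mulr0 mul0r addr0 (le_trans (leA w)) // ler_wpM2l //.
    rewrite lerXn2r ?nnegrE ?mulr_ge0 ?addr_ge0 ?invr_ge0 ?exprn_ge0 ?ler0n //.
    by rewrite ler_peMr // lerDl invr_ge0 exprn_ge0 ?ler0n.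
  have e2_ge0 : 0 <= r / (d%:R ^+ 2 * s).
    by rewrite divr_ge0 // mulr_ge0 // exprn_ge0 ?ler0n.
  pose e := sqrtC (r / (d%:R ^+ 2 * s)).
  have e2 : e ^+ 2 = r / (d%:R ^+ 2 * s) by rewrite sqrtCK.
  have := @poly_coef01_bound _ (line_poly w v p) e (A * (r * (1 + d%:R ^- 2)) ^+ d).
  rewrite sqrtC_ge0 e2_ge0 coef0_line_poly coef1_line_poly -/g -sE.
  rewrite (ger0_norm s_ge0) e2 => /(_ isT) H.
  apply: le_trans (H _) => [|t te].
    rewrite le_eqVlt; apply/orP; left; apply/eqP; congr (_ + _); field.
    by rewrite s_neq0.
  rewrite horner_line_poly (le_trans (leA _)) // lineE te e2 ler_wpM2l //.
  rewrite le_eqVlt; apply/orP; left; apply/eqP; congr (_ ^+ d); field.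
  by rewrite s_neq0 d_neq0.
have -> : sqnorm g = d%:R ^+ 2 / r * (`|p.@[w]| ^+ 2 + r * s / d%:R ^+ 2).
  by rewrite SE; field; rewrite d_neq0.
apply: le_trans (ler_wpM2l _ key) _; first by rewrite divr_ge0 ?exprn_ge0.
rewrite le_eqVlt; apply/orP; left; apply/eqP.
case: d d_gt1 {hp leA d_gt0 d_neq0 D c DE DcE v s orth orthc sE SE lineE s_ge0 key}
  => // d _ /=.
rewrite exprMn (exprS r); move: ((1 + _) ^+ d.+1) => E; move: (d.+1%:R ^+ 2) => x.
by field; rewrite r_neq0.
Qed.
End GradientBound.

(** * Picard iterates of the formal inverse *)

Section Picard.
Variables (A : comNzRingType) (n : nat).
Implicit Types (p q : {mpoly A[n]}) (g h : 'I_n -> {mpoly A[n]}) (m : 'X_{1..n}).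

(** Membership in the k-th power of the ideal generated by the variables; differences in it express
    agreement up to degree k - 1. *)
Definition vanish_below (k : nat) p := forall m, (mdeg m < k)%N -> p@_m = 0.

Lemma vanish_belowW (k l : nat) p :
  vanish_below k p -> (l <= k)%N -> vanish_below l p.
Proof. by move=> p0 le_lk m lt_ml; rewrite p0 // (leq_trans lt_ml). Qed.

Lemma vanish_belowD (k : nat) p q :
  vanish_below k p -> vanish_below k q -> vanish_below k (p + q).
Proof. by move=> p0 q0 m lt_mk; rewrite mcoeffD p0 ?q0 ?addr0. Qed.

Lemma vanish_below_sum (I : eqType) (s : seq I) (k : nat) (F : I -> {mpoly A[n]}) :
  {in s, forall i, vanish_below k (F i)} -> vanish_below k (\sum_(i <- s) F i).
Proof.
move=> F0 m lt_mk; rewrite raddf_sum big1_seq // => i /andP[_ /F0].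
exact.
Qed.

Lemma vanish_belowM (k l : nat) p q :
  vanish_below k p -> vanish_below l q -> vanish_below (k + l) (p * q).
Proof.
move=> p0 q0 m lt_m; rewrite mcoeffM big1 // => -[a b] /= /eqP Dm.
have [lt_ak|le_ka] := ltnP (mdeg a) k; first by rewrite p0 ?mul0r.
rewrite (q0 b) ?mulr0 // -(ltn_add2l k).
have le_b : (k + mdeg b <= mdeg a + mdeg b)%N by rewrite leq_add2r.
by rewrite (leq_ltn_trans le_b) // -mdegD -Dm.
Qed.

Definition mpoly_subst g p := p \mPo [tuple g i | i < n].

Lemma mpoly_substXS g m i :
  mpoly_subst g 'X_[m + U_(i)] = g i * mpoly_subst g 'X_[m].
Proof.
rewrite /mpoly_subst mpolyXD rmorphM mulrC /= comp_mpolyXU.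
by rewrite -tnth_nth tnth_mktuple.
Qed.

Lemma mpoly_substE g p :
  mpoly_subst g p = \sum_(m <- msupp p) p@_m *: mpoly_subst g 'X_[m].
Proof. exact: comp_mpolyEX. Qed.

Lemma mpoly_substX0 g : mpoly_subst g 'X_[0] = 1.
Proof. by rewrite /mpoly_subst mpolyX0 rmorph1. Qed.

Lemma mpoly_substB g : {morph mpoly_subst g : p q / p - q}.
Proof. exact: comp_mpolyB. Qed.

Lemma mpoly_substXU g i : mpoly_subst g 'X_i = g i.
Proof. by rewrite /mpoly_subst comp_mpolyXU -tnth_nth tnth_mktuple. Qed.

Lemma vanish_below_substX g m : (forall i, vanish_below 1 (g i)) ->
  vanish_below (mdeg m) (mpoly_subst g 'X_[m]).
Proof.
move=> g0; elim/mnm_ind: m => [|m i IHm]; first by move=> m; rewrite mdeg0.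
by rewrite mpoly_substXS mdegD mdeg1 addnC; apply: vanish_belowM.
Qed.

Lemma vanish_belowZ (k : nat) c p : vanish_below k p -> vanish_below k (c *: p).
Proof. by move=> p0 m lt_mk; rewrite mcoeffZ p0 ?mulr0. Qed.

Lemma vanish_below_subst (k : nat) g p : (forall i, vanish_below 1 (g i)) ->
  vanish_below k p -> vanish_below k (mpoly_subst g p).
Proof.
move=> g0 p0; rewrite mpoly_substE; apply: vanish_below_sum => m.
rewrite mcoeff_msupp => nz_m; apply: vanish_belowZ.
apply: (vanish_belowW (vanish_below_substX g0)); rewrite leqNgt.
by apply: contra nz_m => /p0 ->.
Qed.

(** Telescoping over the factors of the monomial: one factor contributes the difference, of order k,
    and each of the others has order at least 1. *)
Lemma vanish_below_substXB (k : nat) g h m :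
  (forall i, vanish_below 1 (g i)) -> (forall i, vanish_below 1 (h i)) ->
  (forall i, vanish_below k (g i - h i)) ->
  vanish_below (k + (mdeg m).-1) (mpoly_subst g 'X_[m] - mpoly_subst h 'X_[m]).
Proof.
move=> g0 h0 gh; elim/mnm_ind: m => [|m i IHm].
  by move=> m _; rewrite !mpoly_substX0 subrr mcoeff0.
rewrite !mpoly_substXS mdegD mdeg1 addn1 /=.
have -> : g i * mpoly_subst g 'X_[m] - h i * mpoly_subst h 'X_[m] =
  (g i - h i) * mpoly_subst g 'X_[m] +
  h i * (mpoly_subst g 'X_[m] - mpoly_subst h 'X_[m]) by ring.
apply: vanish_belowD.
  by apply: vanish_belowM => //; apply: vanish_below_substX.
apply: (vanish_belowW (vanish_belowM (h0 i) IHm)).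
by rewrite addnCA leq_add2l add1n leqSpred.
Qed.

(** The contraction property in the adic topology: substituting into a form of degree d + 1 gains d
    orders of agreement. *)
Lemma vanish_below_substB (k d : nat) g h p : p \is d.+1.-homog ->
  (forall i, vanish_below 1 (g i)) -> (forall i, vanish_below 1 (h i)) ->
  (forall i, vanish_below k (g i - h i)) ->
  vanish_below (k + d) (mpoly_subst g p - mpoly_subst h p).
Proof.
move=> hp g0 h0 gh; rewrite !mpoly_substE -sumrB.
apply: vanish_below_sum => m /(dhomog_mf hp) /= dm.
rewrite -scalerBr; apply: vanish_belowZ.
by have := vanish_below_substXB g0 h0 gh (m := m); rewrite dm.
Qed.

Lemma mcoeff_fps_trunc (k : nat) (f : fps A n) m :
  (fps_trunc k f)@_m = if (mdeg m <= k)%N then f m else 0.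
Proof.
rewrite /fps_trunc raddf_sum /=.
under eq_bigr => a _ do rewrite mcoeffZ mcoeffX.
case: ifP => [lt_mk|/negbT nle_mk].
  rewrite (bigD1 (BMultinom (lt_mk : mdeg m < k.+1)%N)) //= eqxx mulr1 big1 ?addr0 //.
  by move=> a; rewrite -val_eqE /= => /negbTE ->; rewrite mulr0.
rewrite big1 // => a _; case: eqP => [am|]; last by rewrite mulr0.
by case/negP: nle_mk; rewrite -am -ltnS bmdeg.
Qed.

(** Iteration of G = z + grad p(G) from 0. The iterates are polynomials, so they can be evaluated
    and estimated pointwise. *)
Fixpoint picard (p : {mpoly A[n]}) (j : nat) (i : 'I_n) : {mpoly A[n]} :=
  if j is j'.+1 then 'X_i + mpoly_subst (picard p j') p^`M(i) else 0.

Lemma formal_inverse_fixpoint (p : {mpoly A[n]}) (G : 'I_n -> fps A n) i m :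
  (forall i, G i 0%MM = 0) ->
  formal_map_comp (fun i => fps_of_mpoly ('X_i - p^`M(i))) G i m =
    formal_map_id A i m ->
  G i m = ('X_i)@_m +
    (mpoly_subst (fun i => fps_trunc (mdeg m) (G i)) p^`M(i))@_m.
Proof.
move=> G0; set g := fun i => fps_trunc (mdeg m) (G i).
rewrite /formal_map_comp /fps_comp.
rewrite -/(mpoly_subst g _) /formal_map_id /fps_of_mpoly.
set F := 'X_i - _; set tF := fps_trunc _ _ => FG.
have g0 j : vanish_below 1 (g j).
  move=> a; rewrite ltnS leqn0 mdeg_eq0 => /eqP ->.
  by rewrite mcoeff_fps_trunc mdeg0 G0.
(* Replacing [F] by its truncation changes only degrees above [mdeg m], and substituting series
   without constant term does not lower the order. *)
have : vanish_below (mdeg m).+1 (mpoly_subst g (tF - F)).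
  apply: vanish_below_subst => // a; rewrite ltnS => le_am.
  by rewrite mcoeffB mcoeff_fps_trunc le_am subrr.
move=> /(_ m (leqnn _)); rewrite mpoly_substB mcoeffB FG => /eqP.
rewrite subr_eq0 => /eqP ->.
by rewrite mpoly_substB mcoeffB mpoly_substXU mcoeff_fps_trunc leqnn subrK.
Qed.

(** The partial derivatives have degree at least 2, so each iteration fixes at least one further
    degree. *)
Lemma mcoeff_picard (d : nat) (p : {mpoly A[n]}) (G : 'I_n -> fps A n) :
  p \is d.+3.-homog -> (forall i, G i 0%MM = 0) ->
  (forall i m, formal_map_comp (fun i => fps_of_mpoly ('X_i - p^`M(i))) G i m =
     formal_map_id A i m) ->
  forall j i m, (mdeg m <= j)%N -> (picard p j i)@_m = G i m.
Proof.
move=> hp G0 FG j; elim: j => [|j IHj] i m le_mj.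
  by move: le_mj; rewrite leqn0 mdeg_eq0 => /eqP ->; rewrite mcoeff0 G0.
rewrite (formal_inverse_fixpoint G0 (FG i m)) /= mcoeffD; congr (_ + _).
apply/eqP; rewrite -subr_eq0 -mcoeffB; apply/eqP.
have homi : p^`M(i) \is d.+2.-homog by apply: dhomog_mderiv.
(* The induction hypothesis reaches degree [j] and the truncation keeps degrees up to [mdeg m];
   agreement holds up to the smaller of the two. *)
have := @vanish_below_substB (minn j (mdeg m)).+1 _ (picard p j)
  (fun i => fps_trunc (mdeg m) (G i)) _ homi; apply.
- move=> l a; rewrite ltnS leqn0 mdeg_eq0 => /eqP ->.
  by rewrite IHj ?mdeg0.
- move=> l a; rewrite ltnS leqn0 mdeg_eq0 => /eqP ->.
  by rewrite mcoeff_fps_trunc mdeg0 G0.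
- move=> l a; rewrite ltnS leq_min => /andP[le_aj le_am].
  by rewrite mcoeffB mcoeff_fps_trunc le_am IHj // subrr.
rewrite addSn addnS ltnS -addSn; apply: leq_trans (leq_addr _ _).
by rewrite -minnSS leq_min le_mj leqnSn.
Qed.
End Picard.

(** * Bounds on the Picard iterates *)

(** With x = 1/d^2 and k = d this bounds (1 + 1/d^2)^d by 1/(1 - 1/d), which is at most 4/3 for d at
    least 4. *)
Lemma bernoulli_recip (R : realFieldType) (x : R) (k : nat) :
  0 <= x -> (1 + x) ^+ k * (1 - k%:R * x) <= 1.
Proof.
move=> x_ge0; elim: k => [|k IHk]; first by rewrite mul0r subr0 mulr1.
apply: le_trans IHk; rewrite exprSr -mulrA ler_wpM2l ?exprn_ge0 ?addr_ge0 //.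
by rewrite -natr1; have := ler0n R k; nra.
Qed.

Lemma gradient_constant_le_real (R : realFieldType) (d : nat) : (4 <= d)%N ->
  d%:R ^+ 2 * (1 + d%:R ^- 2) ^+ d * (9 / 4) ^+ d.-1 <= 4 ^+ d :> R.
Proof.
move=> d_ge4; have d4 : 4 <= d%:R :> R by rewrite (ler_nat _ 4).
have y_ge0 k : 0 <= (9 / 4) ^+ k :> R by rewrite exprn_ge0 // divr_ge0.
have E_le : (1 + d%:R ^- 2) ^+ d <= 4 / 3 :> R.
  have dV : 0 <= d%:R ^- 2 :> R by rewrite invr_ge0 exprn_ge0 ?ler0n.
  have := bernoulli_recip d dV; set E := (1 + _) ^+ d.
  have E_ge0 : 0 <= E by rewrite exprn_ge0 ?addr_ge0.
  have -> : d%:R * d%:R ^- 2 = d%:R^-1 :> R by field; lra.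
  have : d%:R^-1 <= 4^-1 :> R by rewrite lef_pV2 ?posrE; lra.
  by nra.
apply: le_trans (_ : d%:R ^+ 2 * (4 / 3) * (9 / 4) ^+ d.-1 <= _).
  by rewrite ler_wpM2r // ler_wpM2l ?exprn_ge0.
(* Induction from d = 4, where the inequality reads 243 <= 256. *)
rewrite -(subnK d_ge4); elim: (d - 4)%N => [|k IHk].
  by rewrite add0n /= !exprS !expr0; lra.
have x4 : 4 <= k.+4%:R :> R by rewrite (ler_nat _ 4).
rewrite !addn4 /= in IHk *; rewrite -[k.+4.+1%:R]natr1.
rewrite [_ ^+ k.+4]exprS [4 ^+ k.+4.+1]exprS.
move: (k.+4%:R) x4 (_ ^+ k.+3) (y_ge0 k.+3) (4 ^+ k.+4) IHk.
move=> x x4 y y_ge0' z H.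
have le_x : (x + 1) ^+ 2 * (9 / 4) <= 4 * x ^+ 2 by nra.
have := ler_wpM2r (mulr_ge0 (_ : 0 <= 4 / 3) y_ge0') le_x.
by rewrite divr_ge0 // => /(_ isT); lra.
Qed.

Section PicardBound.
Variables (C : numClosedFieldType) (n : nat).
Implicit Types (p : {mpoly C[n]}) (z w : 'I_n -> C) (m : 'X_{1..n}).

(** Both sides are rational, so the inequality transfers from [rat]. *)
Lemma gradient_constant_le (d : nat) : (4 <= d)%N ->
  d%:R ^+ 2 * (1 + d%:R ^- 2) ^+ d * (9 / 4) ^+ d.-1 <= 4 ^+ d :> C.
Proof.
move/(gradient_constant_le_real rat); rewrite -(ler_rat C).
by rewrite !(rmorphM, rmorphXn, rmorphD, rmorph1, fmorphV) /= !ratr_nat.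
Qed.

Lemma gradient_ball (d : nat) p (a r : C) : (4 <= d)%N -> p \is d.-homog ->
  0 <= a -> 0 <= r -> 2 ^+ d.+1 * a * r ^+ d.-2 = 1 ->
  (forall z, `|p.@[z]| ^+ 2 <= a ^+ 2 * sqnorm z ^+ d) ->
  forall w, sqnorm w <= 9 / 4 * r ^+ 2 ->
  sqnorm (fun i => (p^`M(i)).@[w]) <= r ^+ 2 / 4.
Proof.
move=> d_ge4 hp a_ge0 r_ge0 ar lea w le_w.
have a2_ge0 : 0 <= a ^+ 2 by rewrite exprn_ge0.
apply: le_trans (gradient_bound w _ hp a2_ge0 lea) _; first by apply: leq_trans d_ge4.
have := gradient_constant_le d_ge4; set K := d%:R ^+ 2 * _ => K_le.
have K_ge0 : 0 <= K.
  by rewrite mulr_ge0 ?exprn_ge0 ?addr_ge0 ?invr_ge0 ?exprn_ge0 ?ler0n.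
have Ka_ge0 : 0 <= K * a ^+ 2 by rewrite mulr_ge0.
apply: le_trans (_ : _ <= K * a ^+ 2 * (9 / 4 * r ^+ 2) ^+ d.-1) _.
  rewrite ler_wpM2l // lerXn2r ?nnegrE ?sqnorm_ge0 //.
  by rewrite mulr_ge0 ?exprn_ge0 ?divr_ge0.
have -> : K * a ^+ 2 * (9 / 4 * r ^+ 2) ^+ d.-1 =
  K * (9 / 4) ^+ d.-1 * (a ^+ 2 * r ^+ 2 * (r ^+ d.-2) ^+ 2).
  have d1 : d.-1 = d.-2.+1 by case: d d_ge4 {hp ar lea K_le K_ge0 Ka_ge0 K} => [|[|d]].
  have rE : (r ^+ 2) ^+ d.-1 = r ^+ 2 * (r ^+ d.-2) ^+ 2.
    by rewrite d1 exprS -!exprM mulnC.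
  by rewrite exprMn rE; move: (_ ^+ d.-1) (_ ^+ d.-2) => x y; ring.
apply: le_trans (_ : _ <= 4 ^+ d * (a ^+ 2 * r ^+ 2 * (r ^+ d.-2) ^+ 2)) _.
  by rewrite ler_wpM2r // !mulr_ge0 ?exprn_ge0.
(* The square of the normalisation [ar] of the radius appears, leaving exactly r^2 / 4. *)
have -> : 4 ^+ d * (a ^+ 2 * r ^+ 2 * (r ^+ d.-2) ^+ 2) =
  (2 ^+ d.+1 * a * r ^+ d.-2) ^+ 2 * (r ^+ 2 / 4).
  have -> : 4 = 2 ^+ 2 :> C by rewrite -natrX.
  by rewrite -exprM mulnC exprM [2 ^+ d.+1]exprS; field.
by rewrite ar expr1n mul1r.
Qed.

(* The weights make the squared radii r^2 and r^2 / 4 add up to (9/4) r^2. *)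
Lemma sqnormD_le z w : sqnorm (fun i => z i + w i) <= 3 / 2 * sqnorm z + 3 * sqnorm w.
Proof.
rewrite /sqnorm !mulr_sumr -big_split /=; apply: ler_sum => i _.
rewrite -subr_ge0.
have -> : 3 / 2 * `|z i| ^+ 2 + 3 * `|w i| ^+ 2 - `|z i + w i| ^+ 2 =
  2^-1 * `|z i - 2 * w i| ^+ 2.
  by rewrite !normCK rmorphD rmorphB rmorphM /= conjC_nat; field.
by rewrite mulr_ge0 ?exprn_ge0 ?invr_ge0.
Qed.

Lemma picard_bounded p (s : C) (j : nat) z :
  (forall w, sqnorm w <= 9 / 4 * s -> sqnorm (fun i => (p^`M(i)).@[w]) <= s / 4) ->
  sqnorm z <= s -> sqnorm (fun i => (picard p j i).@[z]) <= 9 / 4 * s.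
Proof.
move=> leP le_zs; have s_ge0 := le_trans (sqnorm_ge0 z) le_zs.
elim: j => [|j IHj].
  rewrite /sqnorm big1 => [|i _]; last by rewrite meval0 normr0 expr0n.
  by rewrite mulr_ge0 ?divr_ge0.
apply: le_trans (_ : sqnorm (fun i => z i +
  (p^`M(i)).@[fun k => (picard p j k).@[z]]) <= _); last first.
  apply: le_trans (sqnormD_le _ _) _.
  have -> : 9 / 4 * s = 3 / 2 * s + 3 * (s / 4) by field.
  by rewrite lerD // ler_wpM2l ?divr_ge0 // leP.
rewrite le_eqVlt; apply/orP; left; apply/eqP; apply: eq_bigr => i _.
rewrite /= mevalD mevalXU comp_mpoly_meval; congr (`|_ + _| ^+ 2).
by apply: meval_eq => k; rewrite tnth_mktuple.
Qed.

Lemma inversion_pair_coef_bound (d : nat) p (Q : fps C n) (rho : 'I_n -> C) (r : C) m :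
  p \is d.+3.-homog -> is_inversion_pair p Q ->
  (forall i, 0 <= rho i) -> 0 <= r -> \sum_i rho i ^+ 2 <= r ^+ 2 ->
  (forall w, sqnorm w <= 9 / 4 * r ^+ 2 ->
     sqnorm (fun i => (p^`M(i)).@[w]) <= r ^+ 2 / 4) ->
  `|Q m| * \prod_i rho i ^+ m i <= 5 / 2 * r ^+ 2.
Proof.
move=> hp [Q0 [FG _]] rho_ge0 r_ge0 le_rho leP.
have [lt_m2|le_2m] := ltnP (mdeg m) 2.
  by rewrite Q0 // normr0 mul0r mulr_ge0 ?divr_ge0 ?exprn_ge0.
pose G i : fps C n := fun m => fps_of_mpoly 'X_i m + fps_deriv i Q m.
have G0 i : G i 0%MM = 0.
  rewrite /G /fps_of_mpoly /fps_deriv mcoeffX mnm1_eq0 add0r Q0 ?mul0rn //.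
  by rewrite add0m mdeg1.
have G_bound i m' : `|G i m'| * \prod_i rho i ^+ m' i <= 3 / 2 * r.
  have rhs_ge0 : 0 <= 3 / 2 * r by rewrite mulr_ge0 ?divr_ge0.
  rewrite -(@ler_pXn2r _ 2) ?nnegrE //; last first.
    by rewrite mulr_ge0 // prodr_ge0 // => l _; rewrite exprn_ge0.
  (* The iterate of index [mdeg m'] already has the right coefficient, and the torus lies in the
     ball where the iterates are bounded. *)
  rewrite -(mcoeff_picard hp G0 FG _ (leqnn (mdeg m'))).
  apply: mcoeff_torus_bound => // x xE.
  apply: le_trans (le_sqnorm (fun i => (picard p (mdeg m') i).@[x]) i) _.
  have -> : (3 / 2 * r) ^+ 2 = 9 / 4 * r ^+ 2 by field.
  apply: picard_bounded leP _; apply: le_trans le_rho.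
  by apply: ler_sum => l _; rewrite xE.
have le_rho_r i : rho i <= r.
  rewrite -(@ler_pXn2r _ 2) ?nnegrE //; apply: le_trans le_rho.
  by rewrite (bigD1 i) //= lerDl sumr_ge0 // => j _; rewrite exprn_ge0.
have /existsP[i m_i] : [exists i, m i != 0%N].
  rewrite -negb_forall; apply: contraTN le_2m => /forallP m0.
  by rewrite mdegE big1 // => i _; apply/eqP.
have le_im : (U_(i) <= m)%MM by rewrite lep1mP.
have [m' Dm] : exists m', m = (m' + U_(i))%MM by exists (m - U_(i))%MM; rewrite submK.
have prodU a : \prod_l rho l ^+ (a + U_(i))%MM l = \prod_l rho l ^+ a l * rho i.
  under eq_bigr => l _ do rewrite mnmDE exprD.
  rewrite big_split /=; congr (_ * _); rewrite (bigD1 i) //= mnm1E eqxx big1.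
    by rewrite mulr1.
  by move=> l; rewrite mnm1E eq_sym => /negbTE ->.
have prod_ge0 a : 0 <= \prod_l rho l ^+ a l.
  by rewrite prodr_ge0 // => l _; rewrite exprn_ge0.
(* Differentiation multiplies [Q m] by a positive integer, which only enlarges it; the other term
   accounts for the identity part of [G]. *)
have le_Q : `|Q m| <= `|G i m'| + (U_(i)%MM == m')%:R.
  have -> : `|G i m'| + (U_(i)%MM == m')%:R = `|G i m'| + `|('X_i : {mpoly C[n]})@_m'|.
    by rewrite mcoeffX normr_nat.
  apply: le_trans (ler_normB _ _).
  rewrite /G /fps_of_mpoly /fps_deriv addrAC subrr add0r -Dm normrMn.
  by rewrite mulrS lerDl mulrn_wge0.
rewrite Dm prodU mulrA -Dm.
(* The summands bound [G] and its identity part; the last factor bounds [rho i]. *)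
have -> : 5 / 2 * r ^+ 2 = (3 / 2 * r + r) * r by field.
rewrite ler_pM ?mulr_ge0 //.
apply: le_trans (ler_wpM2r (prod_ge0 m') le_Q) _; rewrite mulrDl lerD //.
case: eqP => [<-|_]; last by rewrite mul0r.
have := prodU 0%MM; rewrite add0m => ->; rewrite mul1r big1 ?mul1r // => l _.
by rewrite mnm0E.
Qed.
End PicardBound.

(** * Convergence *)

Section Convergence.
Variables (R : realType) (n : nat).
Implicit Types (P : {mpoly R[i][n]}) (z : 'I_n -> R[i]) (m : 'X_{1..n}).
Local Open Scope complex_scope.

Lemma normcE (x : R[i]) : (Normc.normc x)%:C = `|x|.
Proof. by case: x. Qed.

Lemma normc_ge0 (x : R[i]) : 0 <= Normc.normc x.
Proof. by rewrite -lecR normcE normr_ge0. Qed.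

Lemma sqr_hermitian_norm z : (hermitian_norm z ^+ 2)%:C = sqnorm z.
Proof.
rewrite sqr_sqrtr; last by apply: sumr_ge0 => i _; rewrite exprn_ge0 // normc_ge0.
by rewrite rmorph_sum; apply: eq_bigr => i _; rewrite rmorphXn /= normcE.
Qed.

Lemma hermitian_norm_ge0 z : 0 <= hermitian_norm z.
Proof. exact: sqrtr_ge0. Qed.

(** Needed for [sup] to be an upper bound. On the sphere every coordinate, hence every monomial, has
    modulus at most 1. *)
Lemma has_ubound_unit_sphere P :
  has_ubound [set Normc.normc P.@[z] | z in @unit_sphere R n].
Proof.
exists (\sum_(m <- msupp P) Normc.normc P@_m) => _ [z /= z1 <-].
have z_le1 i : `|z i| <= 1.
  rewrite -(@ler_pXn2r _ 2) ?nnegrE // expr1n.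
  apply: le_trans (le_sqnorm z i) _.
  by rewrite -sqr_hermitian_norm z1 expr1n.
rewrite -lecR normcE mevalE rmorph_sum /=.
apply: le_trans (ler_norm_sum _ _ _) _; apply: ler_sum => m _.
rewrite normcE normrM ler_piMr // normr_prod prodr_ile1 // => i _.
by rewrite normrX exprn_ge0 // exprn_ile1.
Qed.

Lemma sphere_norm_ge0 P : 0 <= sphere_norm P.
Proof.
rewrite /sphere_norm; set S := image _ _.
have [[x Sx]|S0] := pselect (nonempty S).
  apply: le_trans (ub_le_sup (has_ubound_unit_sphere P) Sx).
  by case: Sx => z _ <-; apply: normc_ge0.
(* On an empty sphere [sup] takes its default value 0. *)
by rewrite sup_out // => -[].
Qed.

Lemma meval_sphere_norm (d : nat) P z : P \is d.+1.-homog ->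
  `|P.@[z]| ^+ 2 <= (sphere_norm P)%:C ^+ 2 * sqnorm z ^+ d.+1.
Proof.
move=> hP; set h := hermitian_norm z.
have [z0|z_neq0] := eqVneq h 0.
  rewrite (meval_dhomog0 hP) ?normr0 ?expr0n /=; last first.
    by rewrite -sqr_hermitian_norm -/h z0 expr0n.
  by rewrite mulr_ge0 ?exprn_ge0 ?sqnorm_ge0 // lecR // sphere_norm_ge0.
have h_gt0 : 0 < h by rewrite lt_def z_neq0 hermitian_norm_ge0.
pose u i := h^-1%:C * z i.
have u1 : @unit_sphere R n u.
  rewrite /unit_sphere /=; apply/eqP.
  rewrite -(@eqrXn2 _ 2) ?hermitian_norm_ge0 // expr1n.
  apply/eqP/complexI; rewrite sqr_hermitian_norm.
  have -> : sqnorm u = (h ^- 2)%:C * sqnorm z.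
    rewrite /sqnorm mulr_sumr; apply: eq_bigr => i _.
    rewrite normrM exprMn ger0_norm; last by rewrite lecR invr_ge0 ltW.
    by rewrite -rmorphXn /= exprVn.
  by rewrite -sqr_hermitian_norm -rmorphM /= mulVf ?expf_neq0.
have -> : P.@[z] = h%:C ^+ d.+1 * P.@[u].
  rewrite -(meval_dhomogZ _ _ hP); apply: meval_eq => i.
  by rewrite /u mulrA -rmorphM /= divff // mul1r.
rewrite normrM exprMn mulrC; apply: ler_pM; rewrite ?exprn_ge0 //.
  rewrite -normcE lerXn2r ?nnegrE ?lecR ?normc_ge0 ?sphere_norm_ge0 //.
  by apply: (ub_le_sup (has_ubound_unit_sphere P)); exists u.
rewrite normrX ger0_norm; last by rewrite lecR ltW.
by rewrite -sqr_hermitian_norm -/h rmorphXn /= -!exprM mulnC.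
Qed.

Lemma sum_geometric_le (q : R) (N : nat) : 0 <= q < 1 ->
  \sum_(k < N) q ^+ k <= (1 - q)^-1.
Proof.
move=> /andP[q_ge0 q_lt1]; rewrite -[_^-1]mul1r ler_pdivlMr ?subr_gt0 //.
have -> : (\sum_(k < N) q ^+ k) * (1 - q) = 1 - q ^+ N.
  by rewrite mulrC -opprB mulNr -subrX1 opprB.
by rewrite lerBlDr lerDl exprn_ge0.
Qed.

(** A finite set of multi-indices lies in a box, and the sum over a box is a product of finite
    geometric sums. *)
Lemma summable_geometric (q : 'I_n -> R) (K : R) (f : 'X_{1..n} -> R) :
  (forall i, 0 <= q i < 1) -> 0 <= K ->
  (forall m, `|f m| <= K * \prod_i q i ^+ m i) ->
  summable setT (fun m => (f m)%:E).
Proof.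
move=> q01 K_ge0 le_f; have q_ge0 i : 0 <= q i by case/andP: (q01 i).
rewrite /summable.
apply: (@le_lt_trans _ _ (K * \prod_i (1 - q i)^-1)%:E); last exact: ltry.
apply: ge_ereal_sup => _ [D [finD _] <-].
rewrite fsbig_finite //=; set s := fset_set D.
rewrite sumEFin lee_fin.
apply: le_trans (ler_sum _ (fun m _ => le_f m)) _.
rewrite -mulr_sumr ler_wpM2l //.
pose N := (\max_(m <- s) mdeg m)%N.
rewrite (@big_box_mnm _ _ N) ?fset_uniq //; last first.
  move=> m s_m i; rewrite ltnS (leq_trans (leq_mdeg m i)) //.
  exact: leq_bigmax_seq.
apply: (@le_trans _ _ (\sum_(j : {ffun 'I_n -> 'I_N.+1}) \prod_i q i ^+ j i)).
  rewrite [leRHS](bigID (fun j => box_mnm j \in s)) /=.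
  under eq_bigr => j _ do under eq_bigr => i _ do rewrite box_mnmE.
  rewrite lerDl sumr_ge0 // => j _.
  by rewrite prodr_ge0 // => i _; rewrite exprn_ge0.
rewrite -(bigA_distr_bigA (fun i (k : 'I_N.+1) => q i ^+ k)).
apply: ler_prod => i _; rewrite sum_geometric_le // andbT.
by apply: sumr_ge0 => k _; rewrite exprn_ge0.
Qed.

Lemma critical_radius (d : nat) (B : R) : (4 <= d)%N -> 0 < B ->
  B * (B `^ (1 / (2 - d%:R))) ^+ d.-2 = 1.
Proof.
move=> d_ge4 B_gt0; rewrite -powR_mulrn ?powR_ge0 // -powRrM.
have -> : 1 / (2 - d%:R) * d.-2%:R = -1 :> R.
  have -> : d.-2%:R = d%:R - 2 :> R by rewrite -natrB ?subn2 // (leq_trans _ d_ge4).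
  have d4 : 4 <= d%:R :> R by rewrite (ler_nat _ 4).
  by field; lra.
by rewrite powR_inv1 ?ltW // divff ?lt0r_neq0.
Qed.

(** Abel's lemma: the terms are dominated by a multiple geometric series of ratios |z_i| / rho_i. *)
Lemma fps_converges_at_bounded (Q : fps R[i] n) z (rho : 'I_n -> R) (K : R) :
  (forall i, Normc.normc (z i) < rho i) ->
  (forall m, `|Q m| * \prod_i (rho i)%:C ^+ m i <= K%:C) ->
  fps_converges_at Q z.
Proof.
move=> lt_rho le_K.
have rho_gt0 i : 0 < rho i := le_lt_trans (normc_ge0 (z i)) (lt_rho i).
pose q i := Normc.normc (z i) / rho i.
have K_ge0 : 0 <= K.
  rewrite -lecR; apply: le_trans (le_K 0%MM).
  by rewrite mulr_ge0 // prodr_ge0 // => i _; rewrite exprn_ge0 // lecR ltW.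
apply: (@summable_geometric q K) => // [i|m].
  by rewrite divr_ge0 ?normc_ge0 ?ltW //= ltr_pdivrMr // mul1r.
rewrite ger0_norm ?normc_ge0 // -lecR normcE normrM normr_prod.
rewrite rmorphM rmorph_prod /=.
have -> : \prod_i `|z i ^+ m i| =
    \prod_i (rho i)%:C ^+ m i * \prod_i (q i ^+ m i)%:C.
  rewrite -big_split /=; apply: eq_bigr => i _.
  rewrite normrX -normcE -!rmorphXn -rmorphM /= -exprMn /q mulrC divfK //.
  by rewrite lt0r_neq0.
rewrite mulrA ler_wpM2r // prodr_ge0 // => i _.
by rewrite lecR exprn_ge0 // divr_ge0 ?normc_ge0 // ltW.
Qed.

Lemma inversion_pair_converges (d : nat) P (Q : fps R[i] n) (r : R) :
  (4 <= d)%N -> P \is d.-homog -> is_inversion_pair P Q ->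
  0 <= r -> 2 ^+ d.+1 * sphere_norm P * r ^+ d.-2 = 1 ->
  fps_converges_on Q (open_ball r).
Proof.
move=> d_ge4 hP PQ r_ge0 rE z; rewrite /open_ball /= => lt_zr.
have lt_z2 : hermitian_norm z ^+ 2 < r ^+ 2.
  by rewrite ltr_pXn2r ?nnegrE ?hermitian_norm_ge0.
(* The slack is shared among the coordinates, so that rho_i^2 = |z_i|^2 + e keeps the torus in the
   ball; [n.+1] avoids a zero divisor. *)
pose e := (r ^+ 2 - hermitian_norm z ^+ 2) / n.+1%:R.
have e_gt0 : 0 < e by rewrite divr_gt0 ?ltr0n ?subr_gt0.
have le_ne : n%:R * e <= r ^+ 2 - hermitian_norm z ^+ 2.
  rewrite /e mulrA ler_pdivrMr ?ltr0n // mulrC ler_wpM2l ?ler_nat //.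
  by rewrite subr_ge0 ltW.
pose rho i := Num.sqrt (Normc.normc (z i) ^+ 2 + e).
have rho2 i : rho i ^+ 2 = Normc.normc (z i) ^+ 2 + e.
  by rewrite sqr_sqrtr // addr_ge0 ?exprn_ge0 ?normc_ge0 // ltW.
have rho_ge0 i : 0 <= rho i by rewrite sqrtr_ge0.
apply: (@fps_converges_at_bounded _ _ rho (5 / 2 * r ^+ 2)) => [i|m].
  by rewrite -(@ltr_pXn2r _ 2) ?nnegrE ?normc_ge0 // rho2 ltrDl.
have -> : (5 / 2 * r ^+ 2)%:C = 5 / 2 * r%:C ^+ 2.
  by rewrite !(rmorphM, rmorphXn, fmorphV) /= !rmorph_nat.
have homP : P \is (d - 3).+3.-homog by rewrite -addn3 subnK // ltnW.
apply: (inversion_pair_coef_bound _ homP PQ) => [i|||].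
- by rewrite lecR.
- by rewrite lecR.
- under eq_bigr => i _ do rewrite -rmorphXn /= rho2.
  rewrite -rmorph_sum -rmorphXn lecR big_split /= sumr_const card_ord -mulr_natl.
  rewrite -lerBrDl (le_trans le_ne) // lerD2l lerN2.
  by rewrite -lecR sqr_hermitian_norm rmorph_sum /= /sqnorm;
     apply: ler_sum => i _; rewrite rmorphXn /= normcE.
- apply: (@gradient_ball _ _ d _ (sphere_norm P)%:C) => //.
  + by rewrite lecR sphere_norm_ge0.
  + by rewrite lecR.
  + have := congr1 (fun x => x%:C) rE.
    by rewrite !(rmorphM, rmorphXn) /= rmorph_nat.
  + by case: d d_ge4 hP {rE homP} => // d _ hP w; apply: meval_sphere_norm.
Qed.
End Convergence.

Theorem proposition3p3 (R : realType) (n d : nat) (P : {mpoly R[i][n]})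
    (Q : fps R[i] n) (r0 : R) :
  (4 <= d)%N ->
  P != 0 ->
  P \is d.-homog ->
  hessian_nilpotent P ->
  is_inversion_pair P Q ->
  r0 = (2 ^+ d.+1 * sphere_norm P) `^ (1 / (2 - d%:R)) ->
  fps_converges_on Q (open_ball r0).
Proof.
move=> d_ge4 _ hP _ PQ r0E.
have r0_ge0 : 0 <= r0 by rewrite r0E powR_ge0.
(* If the sphere norm is 0, the power with nonzero exponent is 0, so [r0 = 0] and the open ball is
   empty. *)
have [A0|A_neq0] := eqVneq (sphere_norm P) 0.
  have r00 : r0 = 0.
    rewrite r0E A0 mulr0 powR0 // mul1r invr_eq0 subr_eq0 (eqr_nat _ 2).
    by case: d d_ge4 {hP r0E} => [|[|[|d]]].
  move=> z; rewrite /open_ball /= r00 => lt_z0.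
  by have := le_lt_trans (hermitian_norm_ge0 z) lt_z0; rewrite ltxx.
apply: (inversion_pair_converges d_ge4 hP PQ r0_ge0).
rewrite r0E; apply: critical_radius => //; rewrite mulr_gt0 ?exprn_gt0 //.
by rewrite lt_def A_neq0 sphere_norm_ge0.
Qed.
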